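(* Let $p$ be a prime, let $K \ge 1$ and $n \ge 1$ be integers with $p^n \ge K$, and let $N = Kp^n+1$. Assume that there exist integers $a$ and $L$ such that: (i) $a^{Kp^{n-1}} \equiv L \pmod N$ and $L \not\equiv 1 \pmod N$, and (ii) $L^p \equiv 1 \pmod N$. Then $N$ is prime. *)

(* Defs.v *)
From mathcomp Require Export all_boot all_order all_algebra.

(* Main.v *)
(* Put [S = 1 + L + ... + L^(p-1)], so that [N] divides [(L - 1) S] but not
   [L - 1]; hence some prime [q] divides both [N] and [S].  If [q] divided
   [L - 1] then [S = p] mod [q], forcing [q = p], although [p] does not divide
   [N].  So [a ^ (K p^(n-1))] is a nontrivial [p]-th root of unity mod [q], the
   order of [a] mod [q] is a multiple of [p^n], and [q = 1] mod [p^n].  The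
   cofactor [N / q] is then [1] mod [p^n] too, and as [K <= p^n] the number
   [K p^n + 1] is too small to have two nontrivial factors of this shape. *)
Require Import Defs.
From mathcomp Require Import all_boot all_order all_algebra finfield zify.

Set Implicit Arguments.
Unset Strict Implicit.
Unset Printing Implicit Defensive.
Import GRing.Theory.

(** A factor [p] in the cofactor of [m] could be cancelled, giving [m %| K * p ^ n]. So the cofactor
    is prime to [p] and Gauss's lemma applies. *)
Lemma prime_pow_dvd_of_dvd_mul (p m K n : nat) : prime p ->
  m %| K * p ^ n.+1 -> ~~ (m %| K * p ^ n) -> p ^ n.+1 %| m.
Proof.
move=> p_pr /dvdnP [c def_c] ndvd.
have cop_c : coprime p c.
  rewrite prime_coprime //; apply: contra ndvd => /dvdnP [e def_e].
  apply/dvdnP; exists e; apply/eqP.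
  rewrite -(eqn_pmul2r (prime_gt0 p_pr)) -mulnA -expnSr def_c def_e.
  by rewrite mulnAC.
rewrite -(@Gauss_dvdr _ c) ?coprimeXl //.
by rewrite -def_c dvdn_mull.
Qed.

(** The order of [x] is a multiple of [p ^ n.+1] by the previous lemma, and it divides [#|F|.-1]
    since [x] is nonzero. *)
Lemma prime_pow_dvd_card_pred (F : finFieldType) (p K n : nat) (x : F) :
  prime p -> 0 < K -> (x ^+ (K * p ^ n.+1) = 1)%R ->
  (x ^+ (K * p ^ n) != 1)%R -> p ^ n.+1 %| #|F|.-1.
Proof.
move=> p_pr K_gt0 x1 xn1.
have e_gt0 : 0 < K * p ^ n.+1 by rewrite muln_gt0 K_gt0 expn_gt0 prime_gt0.
have [m x_m m_dvd] := prim_order_exists e_gt0 x1.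
have x_neq0 : (x != 0)%R.
  by apply/eqP => x0; move/eqP: x1; rewrite x0 expr0n gtn_eqF // eq_sym oner_eq0.
apply: (@dvdn_trans m).
  apply: (prime_pow_dvd_of_dvd_mul p_pr m_dvd).
  by rewrite -(prim_order_dvd x_m) in xn1 *.
rewrite (prim_order_dvd x_m) -(inj_eq (mulfI x_neq0)) -exprS prednK.
  by rewrite expf_card mulr1.
by apply/card_gt0P; exists x.
Qed.

Lemma prime_dvd_geometric_sum (N p : nat) (L : int) : 1 < N ->
  prime p -> ~~ (p %| N) -> ~~ (N %| (L - 1)%R)%Z -> (N %| (L ^+ p - 1)%R)%Z ->
  exists q, [/\ prime q, q %| N, (q %| (L ^+ p - 1)%R)%Z & ~~ (q %| (L - 1)%R)%Z].
Proof.
move=> N_gt1 p_pr p_ndvd N_ndvd; rewrite subrX1.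
set S := (\sum_(i < p) L ^+ i)%R => N_dvd.
(* If [N] were coprime to [S], Gauss's lemma would make it divide [L - 1]. *)
have ncop : gcdn N `|S| != 1.
  apply: contra N_ndvd => cop.
  by rewrite -(@Gauss_dvdzl _ _ S).
have g_gt1 : 1 < gcdn N `|S|.
  by rewrite ltn_neqAle eq_sym ncop gcdn_gt0 ltnW.
have q_pr := pdiv_prime g_gt1.
set q := pdiv _ in q_pr.
have := pdiv_dvd (gcdn N `|S|); rewrite -/q dvdn_gcd => /andP [qN qS].
exists q; split=> //; first by rewrite dvdz_mull.
apply: contra p_ndvd => qL1.
have charF := pchar_Fp q_pr.
have L1 : (L%:~R = 1 :> 'F_q)%R.
  by apply/eqP; rewrite -subr_eq0 -[1%R]/(1%:~R)%R -rmorphB -(dvdz_pcharf charF).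
have Sp : (S%:~R = p%:R :> 'F_q)%R.
  rewrite rmorph_sum /= (eq_bigr (fun=> 1%R)); last first.
    by move=> i _; rewrite rmorphXn /= L1 expr1n.
  by rewrite sumr_const card_ord.
have : q %| p.
  rewrite (dvdn_pcharf charF) -Sp -(dvdz_pcharf charF).
  exact: qS.
by rewrite dvdn_prime2 // => /eqP <-.
Qed.

Lemma eq_of_dvd_mod1 (P K q : nat) : 0 < P -> K <= P -> 1 < q -> P %| q.-1 ->
  q %| K * P + 1 -> q = K * P + 1.
Proof.
move=> P_gt0 leKP q_gt1 /dvdnP [c def_c] /dvdnP [m def_m].
have def_q : q = c * P + 1 by lia.
have m_gt0 : 0 < m by case: m def_m => //; lia.
have /dvdnP [d def_d] : P %| m.-1.
  have -> : m.-1 = K * P - m * c * P by nia.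
  by rewrite dvdn_sub ?dvdn_mull.
(* Here [m = d * P + 1]. If [d = 0], the cofactor [m] is 1; otherwise expanding [m * q] gives
   [K = d + c + d * c * P > P]. *)
case: d def_d => [|d] def_d.
  have m1 : m = 1 by lia.
  by rewrite def_m m1 mul1n.
have def_m' : m = d.+1 * P + 1 by lia.
have c_gt0 : 0 < c by case: c def_q {def_c}; lia.
have : (K * P = (d.+1 + c + d.+1 * c * P) * P).
  by rewrite def_q def_m' in def_m; nia.
move/eqP; rewrite eqn_pmul2r // => /eqP def_K.
have : P <= d.+1 * c * P by rewrite leq_pmull ?muln_gt0.
by move: (_ * P) def_K => x; lia.
Qed.

Theorem theorem2p3 (p K n N : nat)
  (p_prime : prime p) (K_ge1 : (1 <= K)%N) (n_ge1 : (1 <= n)%N)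
  (le_K_pn : (K <= p ^ n)%N) (N_def : N = (K * p ^ n + 1)%N)
  (exists_a_L : exists a L : int,
     [/\ (a ^+ (K * p ^ (n - 1))%N = L %[mod N%:Z])%Z,
         (L <> 1 %[mod N%:Z])%Z
       & (L ^+ p = 1 %[mod N%:Z])%Z]) :
  prime N.
Proof.
case: exists_a_L => a [L [/eqP aL /eqP L1 /eqP Lp]].
rewrite !eqz_mod_dvd in aL L1 Lp.
(* From here on [n.+1] is the original exponent. *)
case: n n_ge1 le_K_pn N_def aL => // n _ le_K_pn N_def; rewrite subn1 /= => aL.
have pn_gt0 : 0 < p ^ n.+1 by rewrite expn_gt0 prime_gt0.
have N_gt1 : 1 < N by rewrite N_def addn1 ltnS muln_gt0 K_ge1.
have p_ndvd : ~~ (p %| N).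
  rewrite N_def dvdn_addr; last by rewrite dvdn_mull // expnS dvdn_mulr.
  by rewrite dvdn1 gtn_eqF // prime_gt1.
have [q [q_pr qN qLp qL1]] := prime_dvd_geometric_sum N_gt1 p_prime p_ndvd L1 Lp.
have charF := pchar_Fp q_pr.
have mod_q (x y : int) : (q %| (x - y)%R)%Z = (x%:~R == y%:~R :> 'F_q)%R.
  by rewrite (dvdz_pcharf charF) rmorphB /= subr_eq0.
have qaL : (q %| (a ^+ (K * p ^ n)%N - L)%R)%Z by apply: dvdz_trans aL.
rewrite mod_q rmorphXn /= in qaL; rewrite !mod_q ?rmorphXn /= in qLp qL1.
have : p ^ n.+1 %| #|'F_q|.-1.
  apply: (@prime_pow_dvd_card_pred _ _ K _ a%:~R%R) => //.
    (* In ['F_q], the power of [a] is [L ^+ p = 1]. *)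
    by rewrite expnSr mulnA exprM (eqP qaL); apply/eqP.
  by rewrite (eqP qaL).
rewrite card_Fp // => q_mod1; rewrite N_def in qN *.
by rewrite -(eq_of_dvd_mod1 pn_gt0 le_K_pn (prime_gt1 q_pr) q_mod1 qN).
Qed.
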